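(* Let $R$ be a $\ast$-ring. The following statements are equivalent: (1) $R$ is nil-$\ast$-reversible. (2) For all $a\in N(R)$ and $b\in R$, $ab\in P(R)$ implies that $ab^{\ast}\in P(R)$ and $b^{\ast}a\in P(R)$.
   Context: All rings are associative with unity. A $\ast$-ring is a ring $R$ equipped with an involution $\ast$, i.e. a map $\ast:R\to R$ with $(x+y)^{\ast}=x^{\ast}+y^{\ast}$, $(xy)^{\ast}=y^{\ast}x^{\ast}$ and $(x^{\ast})^{\ast}=x$ for all $x,y\in R$. $N(R)$ is the set of nilpotent elements of $R$. $P(R)$ is the set of projections of $R$, i.e. elements $p$ with $p=p^{2}=p^{\ast}$. A $\ast$-ring $R$ is nil-$\ast$-reversible if for all $a\in N(R)$ and $b\in R$, $ab=0$ implies $ab^{\ast}=b^{\ast}a=0$. *)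

(* Defs.v *)
From HB Require Import structures.
From mathcomp Require Import all_boot all_order all_algebra.
Set Implicit Arguments.
Unset Strict Implicit.
Unset Printing Implicit Defensive.

Import GRing.Theory.
Local Open Scope ring_scope.

Record is_involution (R : pzRingType) (star : R -> R) : Prop := IsInvolution {
  starD : forall x y, star (x + y) = star x + star y;
  starM : forall x y, star (x * y) = star y * star x;
  starK : forall x, star (star x) = x
}.

Definition nilpotent_elt (R : pzRingType) (a : R) : Prop :=
  exists2 n : nat, (0 < n)%N & a ^+ n = 0.

Definition projection (R : pzRingType) (star : R -> R) (p : R) : Prop :=
  p = p ^+ 2 /\ p = star p.

Definition nil_star_reversible (R : pzRingType) (star : R -> R) : Prop :=
  forall a b : R, nilpotent_elt a ->
    a * b = 0 -> a * star b = 0 /\ star b * a = 0.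

(* Main.v *)
Require Import Defs.
From mathcomp Require Import all_boot all_order all_algebra.
Set Implicit Arguments.
Unset Strict Implicit.
Unset Printing Implicit Defensive.
Local Open Scope ring_scope.

(** Both conditions force the same thing: if [a] is nilpotent and [a * b] is a
    projection, then all the products in sight vanish.

    Applying nil-star-reversibility twice turns [a * b = 0] into [b * a = 0].
    Since [e * r * (1 - e)] and [(1 - e) * r * e] have square zero, this makes
    every idempotent central.  A central idempotent [p = a * b] satisfies
    [p = p * p = a * p * b], hence [p = a ^+ n * p * b ^+ n] for all [n], and so
    [p = 0] when [a] is nilpotent; reversibility then makes the products with
    [star b] zero, and zero is a projection.

    Conversely, let [a * b = 0].  Two applications of the projection condition
    make [b * a] a projection, and [b * a = b * (a * b) * a = 0].  The
    projection [p = a * star b = b * star a] is killed by [a] on the left, hence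
    also on the right, and so [p = p * p = (p * a) * star b = 0].  Finally
    [star b * a] is idempotent with square [star b * p * a = 0]. *)

Import GRing.Theory.

Lemma star0 (R : pzRingType) (star : R -> R) :
  is_involution star -> star 0 = 0.
Proof.
by move=> [sD _ _]; apply: (addrI (star 0)); rewrite -sD !addr0.
Qed.

Lemma projection0 (R : pzRingType) (star : R -> R) :
  is_involution star -> projection star 0.
Proof. by move=> star_inv; split; rewrite ?star0 // expr2 mulr0. Qed.

(** Iterating [p = p * p = a * p * b] moves arbitrarily many factors [a] in
    front of [p]. *)
Lemma central_idempotent_nil_factor (R : pzRingType) (a b : R) :
  nilpotent_elt a -> (a * b) * (a * b) = a * b ->
  (forall x, GRing.comm (a * b) x) -> a * b = 0.
Proof.
move=> [n _ an0] pp pC.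
have pE k : a * b = a ^+ k * (a * b) * b ^+ k.
  elim: k => [|k IHk]; first by rewrite !expr0 mul1r mulr1.
  have papb : a * b = a * (a * b) * b by rewrite -[a * (a * b)]pC -mulrA pp.
  by rewrite {1}IHk {1}papb exprSr exprS !mulrA.
by rewrite (pE n) an0 !mul0r.
Qed.

Section NilStarReversible.

Variables (R : pzRingType) (star : R -> R).
Hypothesis star_inv : is_involution star.
Hypothesis revR : nil_star_reversible star.

Lemma nil_star_reversible_mulC0 (a b : R) :
  nilpotent_elt a -> a * b = 0 -> b * a = 0.
Proof.
move=> nil_a ab0; have [abs0 _] := @revR _ _ nil_a ab0.
by have [_] := @revR _ _ nil_a abs0; rewrite (starK star_inv).
Qed.

(** Swapping the zero product of the square-zero element [e * r * f] with [e]
    brings it back to itself. *)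
Lemma nil_star_reversible_corner0 (e f r : R) :
  e * e = e -> f * e = 0 -> e * r * f = 0.
Proof.
move=> ee fe0.
have nil_erf : nilpotent_elt (e * r * f).
  by exists 2 => //; rewrite expr2 !mulrA -[e * r * f * e]mulrA fe0 mulr0 !mul0r.
have : e * (e * r * f) = 0.
  by apply: nil_star_reversible_mulC0 => //; rewrite -mulrA fe0 mulr0.
by rewrite !mulrA ee.
Qed.

Lemma nil_star_reversible_idempotent_central (e : R) :
  e * e = e -> forall r, GRing.comm e r.
Proof.
move=> ee r; rewrite /GRing.comm.
have e1e : (1 - e) * e = 0 by rewrite mulrBl mul1r ee subrr.
have ee1 : e * (1 - e) = 0 by rewrite mulrBr mulr1 ee subrr.
have ff : (1 - e) * (1 - e) = 1 - e by rewrite mulrBr mulr1 e1e subr0.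
move: (nil_star_reversible_corner0 r ee e1e) => /eqP.
rewrite mulrBr mulr1 subr_eq0 => /eqP ->.
move: (nil_star_reversible_corner0 r ff ee1) => /eqP.
by rewrite !mulrBl mul1r subr_eq0 => /eqP ->.
Qed.

Lemma nil_star_reversible_projection (a b : R) :
  nilpotent_elt a -> projection star (a * b) ->
  projection star (a * star b) /\ projection star (star b * a).
Proof.
move=> nil_a [pp _]; rewrite expr2 in pp.
have pC := nil_star_reversible_idempotent_central (esym pp).
have ab0 := central_idempotent_nil_factor nil_a (esym pp) pC.
by have [-> ->] := @revR _ _ nil_a ab0; split; apply: projection0.
Qed.

End NilStarReversible.

Section ProjectionCondition.

Variables (R : pzRingType) (star : R -> R).
Hypothesis star_inv : is_involution star.
Hypothesis projR : forall a b : R, nilpotent_elt a ->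
  projection star (a * b) ->
  projection star (a * star b) /\ projection star (star b * a).

(** Two uses of the condition show that [b * a] is idempotent, while its square
    contains the factor [a * b]. *)
Lemma projection_condition_mulC0 (a b : R) :
  nilpotent_elt a -> a * b = 0 -> b * a = 0.
Proof.
move=> nil_a ab0.
have [|p_abs _] := @projR a b nil_a; first by rewrite ab0; apply: projection0.
have [_ [+ _]] := projR nil_a p_abs.
rewrite (starK star_inv) => ->.
by rewrite expr2 mulrA -[b * a * b]mulrA ab0 mulr0 mul0r.
Qed.

Lemma projection_condition_nil_star_reversible : nil_star_reversible star.
Proof.
move=> a b nil_a ab0.
have [|[pp ps] [qq _]] := @projR a b nil_a.
  by rewrite ab0; apply: projection0.
have ap0 : a * (a * star b) = 0.
  (* self-adjointness rewrites the second factor as [b * star a] *)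
  by rewrite ps (starM star_inv) (starK star_inv) mulrA ab0 mul0r.
have pa0 := projection_condition_mulC0 nil_a ap0.
have p0 : a * star b = 0 by rewrite pp expr2 mulrA pa0 mul0r.
by split=> //; rewrite qq expr2 mulrA -[star b * a * star b]mulrA p0 mulr0 mul0r.
Qed.

End ProjectionCondition.

Theorem corollary4p13 (R : pzRingType) (star : R -> R)
    (star_inv : is_involution star) :
  nil_star_reversible star <->
  (forall a b : R, nilpotent_elt a ->
     projection star (a * b) ->
     projection star (a * star b) /\ projection star (star b * a)).
Proof.
split=> [revR a b | projR].
  exact: nil_star_reversible_projection.
exact: projection_condition_nil_star_reversible.
Qed.
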